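(* Let $k\ge3$, $q=k-2$, let $r_1,\dots,r_q,m,n$ be positive integers with $m\le n$, and let $$A:\ell_2^{r_1}\times\cdots\times\ell_2^{r_q}\times\ell_2^m\times\ell_2^n\to\mathbb{R}$$ be a sign form with associated operator-valued map $\Phi_A$. Let $\mu$ be the normalized product measure on $S^{r_1-1}\times\cdots\times S^{r_q-1}$ and set $$\delta_k(A):=\frac1{mn^2}\int\|\Phi_A(x)\Phi_A(x)^T-nI_m\|_{\mathrm{HS}}^2\,d\mu(x).$$ Then $$\frac{\|A\|}{\sqrt n}\ge\bigl(1+\delta_k(A)\bigr)^{1/4}.$$ Moreover, the following conditions are equivalent: (i) $\|A\|=\sqrt n$; (ii) $\delta_k(A)=0$; (iii) $\Phi_A(x^{(1)},\ldots,x^{(q)})\,\Phi_A(x^{(1)},\ldots,x^{(q)})^T=n\prod_{\nu=1}^q\|x^{(\nu)}\|_2^2\,I_m$ for all $x^{(\nu)}\in\mathbb{R}^{r_\nu}$, $1\le\nu\le q$. Equivalently, the map $(x^{(1)},\ldots,x^{(q)},y)\mapsto\Phi_A(x^{(1)},\ldots,x^{(q)})^Ty$ is a scaled multilinear orthogonal multiplication, i.e. $\|\Phi_A(x^{(1)},\ldots,x^{(q)})^Ty\|_2=\sqrt n\,\|x^{(1)}\|_2\cdots\|x^{(q)}\|_2\|y\|_2$ for all $x^{(\nu)}\in\mathbb{R}^{r_\nu}$ and $y\in\mathbb{R}^m$.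
   Context: $\ell_2^d$ is $\mathbb{R}^d$ with the Euclidean norm $\|\cdot\|_2$; $\|\cdot\|_{\mathrm{HS}}$ is the Hilbert--Schmidt (Frobenius) norm, and $I_m$ the identity matrix. A sign form is a real $k$-linear form $$A(x^{(1)},\ldots,x^{(q)},y,z)=\sum_{i_1,\ldots,i_q,j,s}\varepsilon_{i_1\cdots i_qjs}\,x^{(1)}_{i_1}\cdots x^{(q)}_{i_q}y_jz_s$$ with all $\varepsilon_{i_1\cdots i_qjs}\in\{-1,1\}$; $\|A\|$ is the supremum of $|A|$ over vectors of Euclidean norm at most $1$ in each variable. For $\alpha=(i_1,\ldots,i_q)$ let $T_\alpha=(\varepsilon_{i_1\cdots i_qjs})_{j,s}\in\{-1,1\}^{m\times n}$ and $$\Phi_A(x^{(1)},\ldots,x^{(q)})=\sum_{i_1,\ldots,i_q}x^{(1)}_{i_1}\cdots x^{(q)}_{i_q}T_{i_1,\ldots,i_q}\in\mathbb{R}^{m\times n},$$ so that $A(x^{(1)},\ldots,x^{(q)},y,z)=\langle\Phi_A(x^{(1)},\ldots,x^{(q)})z,y\rangle$. The measure $\mu$ is the product of the rotation-invariant (normalized surface) probability measures on the unit spheres $S^{r_\nu-1}\subset\mathbb{R}^{r_\nu}$; for $r_\nu=1$, $S^0=\{-1,1\}$ carries the uniform probability measure. *)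

(* Defs.v *)
From mathcomp Require Import all_boot all_order all_algebra.
From mathcomp Require Import ring.
From mathcomp Require Import all_classical all_reals all_analysis.

Set Implicit Arguments.
Unset Strict Implicit.
Unset Printing Implicit Defensive.

Import Order.TTheory GRing.Theory Num.Theory.
Import numFieldNormedType.Exports.

Local Open Scope classical_set_scope.
Local Open Scope ring_scope.

Definition norm2 (R : realType) (d : nat) (x : 'cV[R]_d) : R :=
  Num.sqrt (\sum_(i < d) x i 0 ^+ 2).

Definition hs_norm (R : realType) (m n : nat) (M : 'M[R]_(m, n)) : R :=
  Num.sqrt (\sum_(i < m) \sum_(j < n) M i j ^+ 2).

Definition vecs (R : realType) (q : nat) (r : 'I_q -> nat) : Type :=
  forall nu : 'I_q, 'cV[R]_(r nu).

Notation multi_index r := {dffun forall nu, 'I_(r nu)}.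

Definition is_sign_tensor (R : realType) (q : nat) (r : 'I_q -> nat)
    (m n : nat) (T : multi_index r -> 'M[R]_(m, n)) : Prop :=
  forall alpha j s, T alpha j s = 1 \/ T alpha j s = -1.

Definition tensor_form (R : realType) (q : nat) (r : 'I_q -> nat) (m n : nat)
    (T : multi_index r -> 'M[R]_(m, n))
    (x : vecs R r) (y : 'cV[R]_m) (z : 'cV[R]_n) : R :=
  \sum_(alpha : multi_index r) \sum_(j < m) \sum_(s < n)
    T alpha j s * (\prod_(nu < q) x nu (alpha nu) 0) * y j 0 * z s 0.

(* With T alpha = (eps_(alpha, j, s))_(j, s), this is the operator-valued map
   Phi_A of the form A = tensor_form T. *)
Definition op_map (R : realType) (q : nat) (r : 'I_q -> nat) (m n : nat)
    (T : multi_index r -> 'M[R]_(m, n)) (x : vecs R r) : 'M[R]_(m, n) :=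
  \sum_(alpha : multi_index r) (\prod_(nu < q) x nu (alpha nu) 0) *: T alpha.

Lemma tensor_formE (R : realType) (q : nat) (r : 'I_q -> nat) (m n : nat)
    (T : multi_index r -> 'M[R]_(m, n))
    (x : vecs R r) (y : 'cV[R]_m) (z : 'cV[R]_n) :
  tensor_form T x y z = (y^T *m (op_map T x *m z)) 0 0.
Proof.
rewrite /tensor_form /op_map mulmx_suml mulmx_sumr summxE.
apply: eq_bigr => alpha _; rewrite -scalemxAl -scalemxAr !mxE mulr_sumr.
apply: eq_bigr => j _; rewrite !mxE !mulr_sumr.
by apply: eq_bigr => s _; ring.
Qed.

(* For multilinear A the set is nonempty and bounded above, so that the real sup
   is the supremum. *)
Definition form_norm (R : realType) (q : nat) (r : 'I_q -> nat) (m n : nat)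
    (A : vecs R r -> 'cV[R]_m -> 'cV[R]_n -> R) : R :=
  sup [set a | exists (x : vecs R r) (y : 'cV[R]_m) (z : 'cV[R]_n),
    [/\ forall nu, norm2 (x nu) <= 1, norm2 y <= 1, norm2 z <= 1
      & a = `|A x y z| ] ].

Definition sphere2 (R : realType) (d : nat) : set 'cV[R]_d :=
  [set x | norm2 x = 1].
Arguments sphere2 : clear implicits.

(* Borel sets for the library's topology on matrices, which is the Euclidean
   topology of R^d. *)
Definition borel_cV (R : realType) (d : nat) :=
  g_sigma_algebraType (@open 'cV[R]_d).

Definition cylinders (R : realType) (q : nat) (r : 'I_q -> nat) :
    set (set (vecs R r)) :=
  [set C | exists nu (B : set (borel_cV R (r nu))),
    measurable B /\ C = [set x : vecs R r | B (x nu)] ].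

Definition borel_vecs (R : realType) (q : nat) (r : 'I_q -> nat) :=
  g_sigma_algebraType (@cylinders R q r).

(* The rotation-invariant probability on the unit sphere of R^d, viewed as a
   Borel probability on R^d carried by the sphere. By uniqueness of invariant
   probabilities on homogeneous spaces of compact groups, these two properties
   determine sigma when d > 0. Invariance is under all of O(d): for d >= 2 this
   amounts to invariance under SO(d), and for d = 1 it forces the uniform
   measure on {-1, 1}, whereas SO(1) is trivial. *)
Definition is_sphere_measure (R : realType) (d : nat)
    (sigma : probability (borel_cV R d) R) : Prop :=
  sigma (sphere2 R d) = 1%E /\
  forall (U : 'M[R]_d) (B : set (borel_cV R d)),
    U *m U^T = 1%:M -> measurable B ->
    sigma [set x : 'cV[R]_d | B (U *m x)] = sigma B.

(* The product of finitely many probabilities on different spaces: the values on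
   measurable boxes determine mu on the sigma-algebra generated by cylinders. *)
Definition is_product_measure (R : realType) (q : nat) (r : 'I_q -> nat)
    (sigma : forall nu : 'I_q, probability (borel_cV R (r nu)) R)
    (mu : probability (borel_vecs R r) R) : Prop :=
  forall B : forall nu : 'I_q, set (borel_cV R (r nu)),
    (forall nu, measurable (B nu)) ->
    mu [set x : vecs R r | forall nu, B nu (x nu)] =
    (\prod_(nu < q) sigma nu (B nu))%E.

Definition delta (R : realType) (q : nat) (r : 'I_q -> nat) (m n : nat)
    (T : multi_index r -> 'M[R]_(m, n)) (mu : probability (borel_vecs R r) R) : R :=
  (m%:R * n%:R ^+ 2)^-1 *
  \int[mu]_(x in [set x : vecs R r | forall nu, sphere2 R (r nu) (x nu)])
    hs_norm (op_map T x *m (op_map T x)^T - n%:R%:M) ^+ 2.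

(* Main.v *)
Require Import Defs.
From mathcomp Require Import all_boot all_order all_algebra.
From mathcomp Require Import ring lra.
From mathcomp Require Import all_classical all_reals all_analysis.
From mathcomp Require Import measurable_realfun.

(** Write N for the norm of the form, Phi for its operator-valued map and
    S = Phi Phi^T.

    The inequality comes from computing tr S^2 in two ways. On the product of
    the spheres both Phi and its transpose have operator norm at most N, so
    that tr S^2 <= m N^4 ([hs_norm_gram_le], [op_map_le]). On the other hand
      || S - n I ||^2 = tr S^2 - 2 n tr S + m n^2,
    and the mean of tr S is exactly m n, whatever the signs ([mean_trace]): each
    entry of Phi is a sum of signed monomials, distinct monomials are
    orthogonal because the reflection of one coordinate of one sphere
    preserves mu and changes the sign of their product, and the squares of all
    monomials add up to the product of the squared norms, which is 1 on the
    spheres. Taking means gives n^2 (1 + delta) <= N^4 ([one_add_delta_le]), from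
    which (i) implies (ii) since delta is nonnegative.

    If delta = 0, then S = n I almost everywhere on the spheres, and it must be
    shown that this holds everywhere. The entries of S - n I are, on the
    spheres, quadratic forms in the monomials. Those quadratic forms that vanish
    almost everywhere make up a finite-dimensional space, so a single point of
    the spheres is a common zero of all of them; and this space is invariant
    under the product of the orthogonal groups, which is transitive on the
    product of the spheres. Hence each of its members vanishes everywhere
    ([qform_ae_eq0]). Homogeneity extends the identity to all vectors
    ([delta_eq0_gram]). Finally, (iii) gives the isometry property by
    evaluating <S y, y>, and this property bounds the form by the square root
    of n through the Cauchy-Schwarz inequality, while the main inequality gives
    the opposite bound.

    Both the orthogonality of the monomials and the passage from almost
    everywhere to everywhere rest on the invariance of mu under the product of
    the orthogonal groups. It is inherited from the factors, because measures
    that agree on boxes are equal ([mu_mulmx_vecs]). *)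

Set Implicit Arguments.
Unset Strict Implicit.
Unset Printing Implicit Defensive.

Import Order.TTheory GRing.Theory Num.Theory.
Import numFieldNormedType.Exports.

Local Open Scope classical_set_scope.
Local Open Scope ring_scope.

(** * Euclidean vectors and matrices *)

Section Euclidean.
Context {R : realType}.

Lemma norm2_ge0 d (x : 'cV[R]_d) : 0 <= norm2 x.
Proof. exact: sqrtr_ge0. Qed.

Lemma norm2_sqr d (x : 'cV[R]_d) : norm2 x ^+ 2 = \sum_i x i 0 ^+ 2.
Proof. by rewrite sqr_sqrtr // sumr_ge0 // => i _; exact: sqr_ge0. Qed.

Lemma norm2_sqrE d (x : 'cV[R]_d) : norm2 x ^+ 2 = (x^T *m x) 0 0.
Proof. by rewrite norm2_sqr mxE; apply: eq_bigr => i _; rewrite mxE expr2. Qed.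

Lemma eq_norm2 d (x : 'cV[R]_d) a : 0 <= a -> norm2 x ^+ 2 = a ^+ 2 -> norm2 x = a.
Proof. by move=> a0 /eqP; rewrite eqrXn2 ?norm2_ge0 // => /eqP. Qed.

Lemma norm2_eq0 d (x : 'cV[R]_d) : norm2 x = 0 -> x = 0.
Proof.
move=> /eqP; rewrite -sqrf_eq0 norm2_sqr psumr_eq0; last first.
  by move=> k _; exact: sqr_ge0.
move=> /allP x0; apply/colP => i; rewrite mxE; apply/eqP.
by have := x0 i; rewrite mem_index_enum sqrf_eq0 => /(_ isT).
Qed.

Lemma norm2Z d a (x : 'cV[R]_d) : norm2 (a *: x) = `|a| * norm2 x.
Proof.
apply: eq_norm2; first by rewrite mulr_ge0 ?norm2_ge0.
rewrite exprMn !norm2_sqr real_normK ?num_real // mulr_sumr.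
by apply: eq_bigr => i _; rewrite mxE exprMn.
Qed.

Lemma norm2_0_le1 d : norm2 (0 : 'cV[R]_d) <= 1.
Proof. by rewrite -(scale0r 0) norm2Z normr0 mul0r. Qed.

Lemma norm2_delta d (i : 'I_d) : norm2 (delta_mx i 0 : 'cV[R]_d) = 1.
Proof.
apply: eq_norm2; rewrite // norm2_sqr (bigD1 i) //= big1 => [|k ki].
  by rewrite mxE !eqxx !expr1n addr0.
by rewrite mxE (negPf ki) expr0n.
Qed.

Lemma norm_coord_le d (x : 'cV[R]_d) i : `|x i 0| <= norm2 x.
Proof.
rewrite -ler_sqr ?nnegrE ?norm2_ge0 // real_normK ?num_real // norm2_sqr.
rewrite (bigD1 i) //= lerDl.
by apply: sumr_ge0 => k _; exact: sqr_ge0.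
Qed.

Lemma norm2_mulmx d (U : 'M[R]_d) (x : 'cV[R]_d) :
  U *m U^T = 1%:M -> norm2 (U *m x) = norm2 x.
Proof.
move=> UU; apply: eq_norm2; first exact: norm2_ge0.
by rewrite !norm2_sqrE trmx_mul -mulmxA (mulmxA U^T) (mulmx1C UU) mul1mx.
Qed.

(** The unit vector also exists for x = 0, which lets homogeneity arguments
    avoid a case distinction; this is where the dimension must be positive. *)
Lemma cV_polar d (x : 'cV[R]_d) : (0 < d)%N ->
  exists2 u : 'cV[R]_d, norm2 u = 1 & x = norm2 x *: u.
Proof.
case: d x => // d x _; have [x0|x_neq0] := eqVneq (norm2 x) 0.
  exists (delta_mx 0 0); first exact: norm2_delta.
  by rewrite x0 scale0r; exact: norm2_eq0.
exists ((norm2 x)^-1 *: x); last by rewrite scalerA divff // scale1r.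
by rewrite norm2Z ger0_norm ?invr_ge0 ?norm2_ge0 // mulVf.
Qed.

(** By homogeneity it is enough to treat unit vectors, where each product of
    coordinates is at most the mean of their squares. *)
Lemma cauchy_schwarz d (x y : 'cV[R]_d) :
  `|(x^T *m y) 0 0| <= norm2 x * norm2 y.
Proof.
case: d x y => [|d] x y.
  by rewrite mxE big_ord0 normr0 mulr_ge0 ?norm2_ge0.
have [u u1 ->] := cV_polar x isT; have [v v1 ->] := cV_polar y isT.
rewrite !norm2Z u1 v1 !mulr1 [(_ *: _)^T]linearZ /= -scalemxAl -scalemxAr.
rewrite 2![in leLHS]mxE mulrA 2!normrM.
rewrite -[leRHS]mulr1 ler_wpM2l ?mulr_ge0 // mxE.
apply: le_trans (ler_norm_sum _ _ _) _.
have -> : 1 = \sum_i (u i 0 ^+ 2 + v i 0 ^+ 2) / 2 :> R.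
  by rewrite -mulr_suml big_split /= -!norm2_sqr u1 v1 expr1n; field.
apply: ler_sum => i _; rewrite mxE.
have := sqr_ge0 (u i 0 - v i 0); have := sqr_ge0 (u i 0 + v i 0).
by rewrite ler_norml => *; apply/andP; split; nra.
Qed.

(** Transitivity of the orthogonal group on the sphere, through the Householder
    reflection that exchanges the two vectors. *)
Lemma householder d (u v : 'cV[R]_d) : norm2 u = 1 -> norm2 v = 1 ->
  exists2 U : 'M[R]_d, U *m U^T = 1%:M & U *m u = v.
Proof.
move=> u1 v1; have [<-|uv] := eqVneq u v.
  by exists 1%:M; rewrite ?trmx1 mul1mx.
have uu : u^T *m u = 1%:M by rewrite [LHS]mx11_scalar -norm2_sqrE u1 expr1n.
have vv : v^T *m v = 1%:M by rewrite [LHS]mx11_scalar -norm2_sqrE v1 expr1n.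
pose w := u - v; pose c := (u^T *m v) 0 0.
have uvE : u^T *m v = c%:M by rewrite [LHS]mx11_scalar.
have vuE : v^T *m u = c%:M by rewrite -[LHS]trmxK trmx_mul trmxK uvE tr_scalar_mx.
have wT : w^T = u^T - v^T by rewrite /w linearB.
have wu : w^T *m u = (1 - c)%:M.
  by rewrite wT mulmxBl uu vuE raddfB.
have ww : w^T *m w = (2 * (1 - c))%:M.
  rewrite wT /w mulmxBl !mulmxBr uu vv uvE vuE -!raddfB /=.
  by congr (_%:M); ring.
have c1 : 1 - c != 0.
  apply: contra uv => /eqP c1; rewrite -subr_eq0 -/w; apply/eqP/norm2_eq0.
  by apply: eq_norm2 => //; rewrite norm2_sqrE ww c1 mulr0 !mxE expr0n.
(* the reflection in the hyperplane orthogonal to w, as w^T w = 2 (1 - c) *)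
exists (1%:M - (1 - c)^-1 *: (w *m w^T)).
  have -> : (1%:M - (1 - c)^-1 *: (w *m w^T))^T = 1%:M - (1 - c)^-1 *: (w *m w^T).
    by rewrite linearB /= trmx1 linearZ /= trmx_mul trmxK.
  rewrite mulmxBl !mulmxBr !mul1mx !mulmx1 -scalemxAl -scalemxAr.
  rewrite mulmxA -(mulmxA w) ww mul_mx_scalar -scalemxAl !scalerA.
  have -> : (1 - c)^-1 * ((1 - c)^-1 * (2 * (1 - c))) =
    (1 - c)^-1 + (1 - c)^-1 by field.
  by rewrite scalerDl opprB addrK subrK.
rewrite mulmxBl mul1mx -scalemxAl -mulmxA wu mul_mx_scalar scalerA mulVf //.
by rewrite scale1r /w opprB addrC subrK.
Qed.

Definition flip_mx d (i : 'I_d) : 'M[R]_d :=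
  diag_mx (\row_j (if j == i then -1 else 1)).

Lemma flip_mx_orth d (i : 'I_d) : flip_mx i *m (flip_mx i)^T = 1%:M.
Proof.
rewrite tr_diag_mx mulmx_diag -diag_const_mx; congr diag_mx.
by apply/rowP => j; rewrite !mxE; case: ifP => _; rewrite ?mulrNN mulr1.
Qed.

Lemma flip_mxE d (i j : 'I_d) (x : 'cV[R]_d) :
  (flip_mx i *m x) j 0 = (if j == i then -1 else 1) * x j 0.
Proof. by rewrite mul_diag_mx !mxE. Qed.

Lemma hs_norm_sqr m n (M : 'M[R]_(m, n)) :
  hs_norm M ^+ 2 = \sum_i \sum_j M i j ^+ 2.
Proof.
by rewrite sqr_sqrtr // sumr_ge0 // => i _; apply: sumr_ge0 => j _; exact: sqr_ge0.
Qed.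

Lemma hs_norm_sub_scalar m (S : 'M[R]_m) (a : R) :
  hs_norm (S - a%:M) ^+ 2 = hs_norm S ^+ 2 - 2 * a * \tr S + m%:R * a ^+ 2.
Proof.
rewrite !hs_norm_sqr /mxtrace mulr_sumr.
have -> : m%:R * a ^+ 2 = \sum_(i < m) a ^+ 2 by rewrite sumr_const card_ord mulr_natl.
rewrite -sumrB -big_split /=; apply: eq_bigr => i _.
rewrite (bigD1 i) //= [in RHS](bigD1 i) //= !mxE eqxx mulr1n.
under eq_bigr => j ji do rewrite !mxE eq_sym (negPf ji) mulr0n subr0.
by ring.
Qed.

(** The bilinear form is tested on z normalized and on the direction of
    M z. *)
Lemma norm2_mulmx_le m n (M : 'M[R]_(m, n)) (K : R) : (0 < m)%N -> (0 < n)%N ->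
    (forall (u : 'cV_m) (v : 'cV_n), norm2 u = 1 -> norm2 v = 1 ->
      (u^T *m (M *m v)) 0 0 <= K) ->
  forall z, norm2 (M *m z) <= K * norm2 z.
Proof.
move=> m0 n0 MK z; have [v v1 zE] := cV_polar z n0.
have [u u1 uE] := cV_polar (M *m z) m0.
have -> : norm2 (M *m z) = norm2 z * (u^T *m (M *m v)) 0 0.
  transitivity ((u^T *m (M *m z)) 0 0).
    rewrite uE norm2Z u1 -scalemxAr mxE -norm2_sqrE u1 expr1n !mulr1.
    by rewrite ger0_norm ?norm2_ge0.
  by rewrite {1}zE -!scalemxAr mxE.
by rewrite mulrC ler_wpM2r ?norm2_ge0 // MK.
Qed.

(** The columns of M M^T are the images of the m basis vectors, each of norm
    at most K^2. *)
Lemma hs_norm_gram_le m n (M : 'M[R]_(m, n)) (K : R) :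
    (forall z, norm2 (M *m z) <= K * norm2 z) ->
    (forall y, norm2 (M^T *m y) <= K * norm2 y) ->
  hs_norm (M *m M^T) ^+ 2 <= m%:R * K ^+ 4.
Proof.
move=> MK MTK; rewrite hs_norm_sqr exchange_big /=.
have -> : m%:R * K ^+ 4 = \sum_(j < m) K ^+ 4 :> R.
  by rewrite sumr_const card_ord mulr_natl.
apply: ler_sum => j _.
have e1 := norm2_delta j.
have K0 : 0 <= K.
  by have := MTK (delta_mx j 0); rewrite e1 mulr1; apply: le_trans; exact: norm2_ge0.
have -> : \sum_i (M *m M^T) i j ^+ 2 = norm2 (M *m (M^T *m delta_mx j 0)) ^+ 2.
  by rewrite norm2_sqr mulmxA -colE; apply: eq_bigr => i _; rewrite [in RHS]mxE.
rewrite (_ : K ^+ 4 = (K * K) ^+ 2); last by ring.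
rewrite ler_sqr ?nnegrE ?norm2_ge0 ?mulr_ge0 //.
apply: le_trans (MK _) _; rewrite ler_wpM2l //.
by apply: le_trans (MTK _) _; rewrite e1 mulr1.
Qed.

End Euclidean.

(** * Borel sets and the product measure *)

Section BorelVectors.
Context {R : realType}.

(** Matrices carry the product topology of their entries. *)
Lemma continuous_mx_entries (X : topologicalType) (a b : nat)
    (f : X -> 'M[R]_(a, b)) :
  (forall i j, continuous (fun x => f x i j)) -> continuous f.
Proof.
move=> cf x A [P nP sPA].
have : \forall y \near x, forall i j, P i j (f y i j).
  by apply: filter_forall => i; apply: filter_forall => j; exact: (cf i j x).
by apply: filterS => y Py; exact: sPA.
Qed.

Lemma continuous_mulmxl (a b : nat) (U : 'M[R]_(a, b)) :
  continuous (fun x : 'cV[R]_b => U *m x).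
Proof.
apply: continuous_mx_entries => i j.
under eq_fun do rewrite mxE.
move=> x; apply: cvg_big => [||k _]; [exact: add_continuous|exact: nbhs_filter|].
apply: (@continuousM R _ (fun=> U i k) (fun y : 'cV[R]_b => y k j)).
  exact: cst_continuous.
exact: coord_continuous.
Qed.

Lemma measurable_mulmxl (d : nat) (U : 'M[R]_d) (B : set (borel_cV R d)) :
  measurable B -> measurable ([set x | B (U *m x)] : set (borel_cV R d)).
Proof.
have : measurable_fun [set: borel_cV R d]
    ((fun x : 'cV[R]_d => U *m x) : borel_cV R d -> borel_cV R d).
  apply: (@measurability _ _ (borel_cV R d) (borel_cV R d) setT
            (fun x : 'cV[R]_d => U *m x) (@open 'cV[R]_d)) => //.
  move=> _ [V oV <-]; rewrite setTI; apply: sub_sigma_algebra.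
  by apply: open_comp => // x _; exact: continuous_mulmxl.
by move=> + mB => /(_ measurableT _ mB); rewrite setTI.
Qed.

Lemma measurable_coord (d : nat) (i : 'I_d) :
  measurable_fun [set: borel_cV R d] ((fun x : 'cV[R]_d => x i 0) : borel_cV R d -> R).
Proof.
apply: (measurability _ (RGenOInfty.measurableE R)).
move=> _ [_ [a ->] <-]; rewrite setTI; apply: sub_sigma_algebra.
apply: open_comp; last exact: interval_open.
by move=> x _; exact: coord_continuous.
Qed.

Lemma measurable_sphere2 (d : nat) :
  measurable (sphere2 R d : set (borel_cV R d)).
Proof.
have -> : sphere2 R d =
    (fun x : 'cV[R]_d => \sum_i x i 0 ^+ 2) @^-1` [set 1].
  apply/seteqP; split=> x /=; rewrite /sphere2/= /norm2.
    move=> x1; rewrite -[LHS]sqr_sqrtr ?x1 ?expr1n //.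
    by apply: sumr_ge0 => i _; exact: sqr_ge0.
  by move=> ->; rewrite sqrtr1.
rewrite -[X in measurable X]setTI.
apply: (measurable_sum (T := borel_cV R d)) => //.
by move=> i; apply: measurable_funX; exact: measurable_coord.
Qed.

End BorelVectors.

Section Boxes.
Context {R : realType} {q : nat} {r : 'I_q -> nat}.

Definition mulmx_vecs (U : forall nu, 'M[R]_(r nu)) (x : vecs R r) : vecs R r :=
  fun nu => U nu *m x nu.

Definition box (B : forall nu, set (borel_cV R (r nu))) : set (borel_vecs R r) :=
  [set x : vecs R r | forall nu, B nu (x nu)].

Definition spheres : set (borel_vecs R r) := box (fun nu => sphere2 R (r nu)).

Lemma measurable_cylinder nu (B : set (borel_cV R (r nu))) :
  measurable B -> measurable ([set x : vecs R r | B (x nu)] : set (borel_vecs R r)).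
Proof. by move=> mB; apply: sub_sigma_algebra; exists nu, B. Qed.

Lemma measurable_box (B : forall nu, set (borel_cV R (r nu))) :
  (forall nu, measurable (B nu)) -> measurable (box B).
Proof.
move=> mB.
have -> : box B = \bigcap_(nu in [set: 'I_q]) [set x : vecs R r | B nu (x nu)].
  by apply/seteqP; split=> x /= Bx nu => [_|]; exact: Bx.
apply: fin_bigcap_measurable => // nu _; exact: measurable_cylinder.
Qed.

Lemma measurable_spheres : measurable spheres.
Proof. by apply: measurable_box => nu; exact: measurable_sphere2. Qed.

Lemma cylinder_box nu (B : set (borel_cV R (r nu))) :
  [set x : vecs R r | B (x nu)] = box (dfwith (fun mu => [set: 'cV[R]_(r mu)]) nu B).
Proof.
apply/seteqP; split=> x /=; last by move/(_ nu); rewrite dfwithin.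
by move=> Bx k; case: dfwithP.
Qed.

Lemma measurable_mulmx_vecs (U : forall nu, 'M[R]_(r nu)) :
  measurable_fun [set: borel_vecs R r]
    (mulmx_vecs U : borel_vecs R r -> borel_vecs R r).
Proof.
apply: (@measurability _ _ (borel_vecs R r) (borel_vecs R r) setT
          (mulmx_vecs U) (@cylinders R q r)) => //.
move=> _ [_ [nu [B [mB ->]]] <-]; rewrite setTI.
apply: (measurable_cylinder (B := [set y : 'cV[R]_(r nu) | B (U nu *m y)])).
exact: measurable_mulmxl.
Qed.

Lemma spheres_mulmx (U : forall nu, 'M[R]_(r nu)) (x : vecs R r) :
    (forall nu, U nu *m (U nu)^T = 1%:M) ->
  spheres (mulmx_vecs U x) <-> spheres x.
Proof.
by move=> UU; split=> Sx nu; have := Sx nu; rewrite /sphere2 /= norm2_mulmx.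
Qed.

Lemma spheres_transitive (x y : vecs R r) : spheres x -> spheres y ->
  exists2 U : forall nu, 'M[R]_(r nu), forall nu, U nu *m (U nu)^T = 1%:M &
    y = mulmx_vecs U x.
Proof.
move=> Sx Sy; have U_ nu : {U : 'M[R]_(r nu) | U *m U^T = 1%:M & U *m x nu = y nu}.
  apply/cid2; apply: householder; [exact: Sx|exact: Sy].
exists (fun nu => s2val (U_ nu)) => [nu|]; first exact: s2valP (U_ nu).
by apply/functional_extensionality_dep => nu; rewrite /mulmx_vecs (s2valP' (U_ nu)).
Qed.

Context (sigma : forall nu, probability (borel_cV R (r nu)) R)
  (sigma_sphere : forall nu, is_sphere_measure (sigma nu))
  (mu : probability (borel_vecs R r) R) (mu_prod : is_product_measure sigma mu).

Lemma mu_spheres : mu spheres = 1%E.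
Proof.
rewrite mu_prod => [|nu]; last exact: measurable_sphere2.
by rewrite big1 // => nu _; have [] := sigma_sphere nu.
Qed.

(** The image of mu agrees with mu on boxes, since each factor is invariant;
    boxes are stable under intersection and generate the sigma-algebra. *)
Lemma mu_mulmx_vecs (U : forall nu, 'M[R]_(r nu)) (A : set (borel_vecs R r)) :
    (forall nu, U nu *m (U nu)^T = 1%:M) -> measurable A ->
  mu (mulmx_vecs U @^-1` A) = mu A.
Proof.
move=> U_orth mA.
pose G := [set C | exists B : forall nu, set (borel_cV R (r nu)),
  (forall nu, measurable (B nu)) /\ C = box B].
pose f : borel_vecs R r -> borel_vecs R r := mulmx_vecs U.
have mU : measurable_fun setT f := measurable_mulmx_vecs U.
apply: (g_sigma_algebra_measure_unique G _ (fun=> setT) _ _ (pushforward mu f) mu) => //.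
- by move=> _ [B [mB ->]]; exact: measurable_box.
- by move=> _; exists (fun=> setT); split=> //; apply/seteqP.
- by apply: bigcup_const; exists 0%N.
- move=> _ _ [B [mB ->]] [C [mC ->]]; exists (fun nu => B nu `&` C nu).
  split=> [nu|]; first by apply: measurableI; [exact: mB|exact: mC].
  apply/seteqP; split=> x /= => [[Bx Cx] nu|BCx]; first by split.
  by split=> nu; have [] := BCx nu.
- move=> _ [B [mB ->]]; rewrite /= /pushforward.
  have := @mu_prod (fun nu => [set x : 'cV[R]_(r nu) | B nu (U nu *m x)]).
  rewrite /box => ->; last by move=> nu; exact: measurable_mulmxl.
  rewrite mu_prod //; apply: eq_bigr => nu _.
  by have [_ ->] := sigma_sphere nu.
- by move=> k; rewrite /= /pushforward preimage_setT probability_setT ltry.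
- apply: sub_sigma_algebra2 mA => _ [nu [B [mB ->]]].
  rewrite cylinder_box; eexists; split=> // k.
  by case: dfwithP.
Qed.

End Boxes.

(** * Monomials and quadratic forms in them *)

(** Distributivity for factors with different index types, by transport from
    functions into the disjoint union of these types. *)
Lemma big_distr_dffun (K : comNzRingType) (I : finType) (J : I -> finType)
    (F : forall i, J i -> K) :
  \prod_i \sum_j F i j = \sum_(f : {dffun forall i, J i}) \prod_i F i (f i).
Proof.
pose F' i : {ffun J i -> K} := [ffun j => F i j].
transitivity (\prod_i \sum_j F' i j).
  by apply: eq_bigr => i _; apply: eq_bigr => j _; rewrite ffunE.
under eq_bigr => i _ do rewrite (big_tag (fun i => F' i) i).
rewrite bigA_distr_big_dep -big_fprod.
rewrite (reindex (@dffun_of_fprod _ J)) /=; last exact/onW_bij/dffun_of_fprod_bij.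
by apply: eq_bigr => t _; apply: eq_bigr => i _; rewrite !ffunE.
Qed.

(** A family of largest rank among those contained in P spans P: adding a member
    of P outside its span would increase the rank. *)
Lemma ex_finite_generators (K : fieldType) (V : vectType K) (P : V -> Prop) :
  exists s : seq V, (forall v, v \in s -> P v) /\ forall v, P v -> v \in span s.
Proof.
pose Q d := `[< exists s : seq V, (forall v, v \in s -> P v) /\ \dim (span s) = d >].
have Q0 : exists d, Q d by exists 0%N; apply/asboolP; exists [::]; rewrite span_nil dimv0.
have Qle d : Q d -> (d <= \dim {:V})%N.
  by move=> /asboolP[s [_ <-]]; exact/dimvS/subvf.
case: (ex_maxnP Q0 Qle) => d /asboolP[s [Ps ds]] dmax.
exists s; split=> // v Pv; apply: contraT => vs.
have : (\dim (span (v :: s)) <= d)%N.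
  apply: dmax; apply/asboolP; exists (v :: s); split=> // w.
  by rewrite inE => /predU1P[->|/Ps].
rewrite -ds span_cons; apply: contraTT => _; rewrite -ltnNge.
have sub : (span s <= <[v]> + span s)%VS by exact: addvSr.
rewrite ltn_neqAle dimvS // andbT; apply: contra vs => /eqP eqd.
have /eqP -> : span s == (<[v]> + span s)%VS by rewrite eqEdim sub eqd leqnn.
exact: subvP (addvSl _ _) _ (memv_line v).
Qed.

Section Monomials.
Context {R : realType} {q : nat} {r : 'I_q -> nat}.
Implicit Types (x : vecs R r) (alpha beta : multi_index r).

Definition mono x alpha : R := \prod_(nu < q) x nu (alpha nu) 0.

(** Quadratic forms in the monomials. The coefficients take values in R^o so that
    the forms make up a vector space over R. *)
Definition qform (c : {ffun multi_index r * multi_index r -> R^o}) x : R :=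
  \sum_p c p * (mono x p.1 * mono x p.2).

Lemma mono_scale (a : 'I_q -> R) (x : vecs R r) alpha :
  mono (fun nu => a nu *: x nu) alpha = (\prod_nu a nu) * mono x alpha.
Proof. by rewrite /mono -big_split; apply: eq_bigr => nu _; rewrite mxE. Qed.

Lemma sum_mono_sqr x : \sum_alpha mono x alpha ^+ 2 = \prod_nu norm2 (x nu) ^+ 2.
Proof.
under [RHS]eq_bigr do rewrite norm2_sqr.
rewrite big_distr_dffun; apply: eq_bigr => alpha _.
by rewrite /mono -prodrXl.
Qed.

Lemma mono_mulmx (U : forall nu, 'M[R]_(r nu)) x alpha :
  mono (mulmx_vecs U x) alpha =
  \sum_(beta : multi_index r) (\prod_nu U nu (alpha nu) (beta nu)) * mono x beta.
Proof.
rewrite /mono /mulmx_vecs; under eq_bigr do rewrite mxE.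
by rewrite big_distr_dffun; apply: eq_bigr => beta _; rewrite big_split.
Qed.

(** A linear change of variables in each factor acts linearly on the monomials,
    hence preserves the space of quadratic forms. *)
Lemma qform_mulmx (U : forall nu, 'M[R]_(r nu)) c :
  exists c', forall x, qform c (mulmx_vecs U x) = qform c' x.
Proof.
pose M (alpha beta : multi_index r) := \prod_nu U nu (alpha nu) (beta nu).
exists [ffun p => \sum_p' c p' * (M p'.1 p.1 * M p'.2 p.2)] => x.
rewrite /qform; under [RHS]eq_bigr do rewrite ffunE mulr_suml.
rewrite exchange_big /=; apply: eq_bigr => p' _.
rewrite !mono_mulmx; under [RHS]eq_bigr do rewrite -mulrA.
rewrite -mulr_sumr; congr (_ * _); rewrite mulr_suml.
under eq_bigr do rewrite mulr_sumr.
by rewrite pair_bigA; apply: eq_bigr => p _; rewrite mulrACA.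
Qed.

Lemma qform_span x (s : seq {ffun multi_index r * multi_index r -> R^o}) c :
  (forall c', c' \in s -> qform c' x = 0) -> c \in span s -> qform c x = 0.
Proof.
move=> s0 cs; rewrite (coord_span (X := in_tuple s) cs) /qform.
under eq_bigr do rewrite sum_ffunE mulr_suml.
rewrite exchange_big big1 // => i _.
under eq_bigr do rewrite ffunE -mulrA.
rewrite -mulr_sumr [X in _ * X](s0 (in_tuple s)`_i) ?mulr0 //.
by rewrite mem_nth.
Qed.

End Monomials.

(** * Means over the product of the spheres *)

Section Means.
Context {R : realType} {q : nat} {r : 'I_q -> nat}.

(** Polynomials in the coordinates are measurable, but bounded only on the
    spheres; this is enough for them to be integrable there. *)
Definition tame (f : vecs R r -> R) :=
  measurable_fun [set: borel_vecs R r] (f : borel_vecs R r -> R) /\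
  exists M, forall x, spheres x -> `|f x| <= M.

Lemma tame_cst a : tame (fun=> a).
Proof. by split; [exact: measurable_cst|exists `|a|]. Qed.

Lemma tameD f g : tame f -> tame g -> tame (fun x => f x + g x).
Proof.
move=> [mf [M fM]] [mg [N gN]]; split; first exact: measurable_funD.
by exists (M + N) => x Sx; rewrite (le_trans (ler_normD _ _)) // lerD ?fM ?gN.
Qed.

Lemma tameM f g : tame f -> tame g -> tame (fun x => f x * g x).
Proof.
move=> [mf [M fM]] [mg [N gN]]; split; first exact: measurable_funM.
by exists (M * N) => x Sx; rewrite normrM ler_pM ?fM ?gN.
Qed.

Lemma tame_sum (I : Type) (s : seq I) (f : I -> vecs R r -> R) :
  (forall i, tame (f i)) -> tame (fun x => \sum_(i <- s) f i x).
Proof.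
move=> tf; elim: s => [|i s IHs].
  by under eq_fun do rewrite big_nil; exact: tame_cst.
by under eq_fun do rewrite big_cons; exact: tameD.
Qed.

Lemma tame_prod (I : Type) (s : seq I) (f : I -> vecs R r -> R) :
  (forall i, tame (f i)) -> tame (fun x => \prod_(i <- s) f i x).
Proof.
move=> tf; elim: s => [|i s IHs].
  by under eq_fun do rewrite big_nil; exact: tame_cst.
by under eq_fun do rewrite big_cons; exact: tameM.
Qed.

Lemma tame_coord nu i : tame (fun x => x nu i 0).
Proof.
split.
  have mnu : measurable_fun [set: borel_vecs R r]
      ((fun x => x nu) : borel_vecs R r -> borel_cV R (r nu)).
    by move=> _ B mB; rewrite setTI; exact: measurable_cylinder.
  exact: (measurableT_comp (measurable_coord i) mnu).
by exists 1 => x /(_ nu) x1; rewrite -[leRHS]x1; exact: norm_coord_le.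
Qed.

Lemma tame_mono alpha : tame (fun x => mono x alpha).
Proof. by apply: tame_prod => nu; exact: tame_coord. Qed.

Lemma tame_qform c : tame (fun x => qform c x).
Proof.
apply: tame_sum => p; apply: tameM; first exact: tame_cst.
by apply: tameM; exact: tame_mono.
Qed.

Context (sigma : forall nu, probability (borel_cV R (r nu)) R)
  (sigma_sphere : forall nu, is_sphere_measure (sigma nu))
  (mu : probability (borel_vecs R r) R) (mu_prod : is_product_measure sigma mu).

Lemma tame_integrable f : tame f -> mu.-integrable spheres (EFin \o f).
Proof.
move=> [mf [M fM]]; apply: measurable_bounded_integrable.
- exact: measurable_spheres.
- by rewrite [X in (X < _)%E](mu_spheres sigma_sphere mu_prod) ltry.
- exact: measurable_funTS.
- exists M; split; first exact: num_real.
  by move=> N MN x /= Sx; rewrite (le_trans (fM x Sx)) // ltW.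
Qed.

Local Notation E f := (\int[mu]_(x in spheres) f x).

Lemma mean_cst a : E (fun=> a) = a.
Proof.
rewrite Rintegral_cst; last exact: measurable_spheres.
by rewrite [X in fine X](mu_spheres sigma_sphere mu_prod) mulr1.
Qed.

Lemma mean_sum (I : Type) (s : seq I) (f : I -> vecs R r -> R) :
  (forall i, tame (f i)) ->
  E (fun x => \sum_(i <- s) f i x) = \sum_(i <- s) E (f i).
Proof.
move=> tf; elim: s => [|i s IHs].
  rewrite big_nil; under eq_Rintegral do rewrite big_nil.
  exact: mean_cst.
rewrite big_cons -IHs; under eq_Rintegral do rewrite big_cons.
rewrite RintegralD //; first exact: measurable_spheres.
  exact: tame_integrable.
by apply: tame_integrable; exact: tame_sum.
Qed.

Lemma meanZ a f : tame f -> E (fun x => a * f x) = a * E f.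
Proof.
move=> tf; rewrite RintegralZl //; first exact: measurable_spheres.
exact: tame_integrable.
Qed.

Lemma mean_mulmx (U : forall nu, 'M[R]_(r nu)) f :
    (forall nu, U nu *m (U nu)^T = 1%:M) -> tame f ->
  E (fun x => f (mulmx_vecs U x)) = E f.
Proof.
move=> UU [mf [M fM]].
pose u : borel_vecs R r -> borel_vecs R r := mulmx_vecs U.
have mU : measurable_fun setT u := measurable_mulmx_vecs U.
have uS : u @^-1` spheres = spheres.
  by apply/seteqP; split=> x /spheres_mulmx; exact.
have tfu : tame (f \o u).
  split; first exact: measurableT_comp mf mU.
  by exists M => x Sx; apply: fM; exact/spheres_mulmx.
rewrite /Rintegral; congr fine.
rewrite [RHS](@eq_measure_integral _ _ _ _ (pushforward mu u)); last first.
  by move=> A mA _; exact: esym (mu_mulmx_vecs sigma_sphere mu_prod UU mA).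
have mfE : measurable_fun [set: borel_vecs R r] (EFin \o f) by apply/measurable_EFinP.
have ifu : mu.-integrable (u @^-1` spheres) ((EFin \o f) \o u).
  by rewrite uS; exact: tame_integrable tfu.
have := integral_pushforward mU mfE ifu measurable_spheres.
by rewrite uS => /esym.
Qed.

(** Some sphere has different indices in alpha and in beta: reflecting its
    coordinate of index [alpha nu] changes the sign of the first monomial only. *)
Lemma mean_mono_mono alpha beta : alpha != beta ->
  E (fun x => mono x alpha * mono x beta) = 0.
Proof.
move=> ab; have [nu nuab] : exists nu, alpha nu != beta nu.
  apply/existsP; apply: contraNT ab; rewrite negb_exists => /forallP ab.
  by apply/eqP/ffunP => nu; apply/eqP; rewrite -[_ == _]negbK ab.
pose U k : 'M[R]_(r k) := if k == nu then flip_mx (alpha k) else 1%:M.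
have UU k : U k *m (U k)^T = 1%:M.
  by rewrite /U; case: eqP => _; rewrite ?trmx1 ?mul1mx // flip_mx_orth.
have monoU x gamma : mono (mulmx_vecs U x) gamma =
    (if gamma nu == alpha nu then -1 else 1) * mono x gamma.
  rewrite /mono (bigD1 nu) //= [in RHS](bigD1 nu) //= mulrA; congr (_ * _).
    by rewrite /mulmx_vecs /U eqxx flip_mxE.
  by apply: eq_bigr => k /negPf knu; rewrite /mulmx_vecs /U knu mul1mx.
have tab : tame (fun x => mono x alpha * mono x beta).
  by apply: tameM; exact: tame_mono.
apply/eqP; rewrite -[_ == 0](mulrn_eq0 _ 2) mulr2n.
rewrite -[X in X + _](mean_mulmx UU tab) /=.
under eq_Rintegral do rewrite !monoU eqxx eq_sym (negPf nuab) mul1r mulN1r mulNr -mulN1r.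
by rewrite meanZ // mulN1r addNr.
Qed.

(** In the expansion of the square only the diagonal terms have a nonzero mean.
    Signs disappear from them, and the squared monomials add up to 1. *)
Lemma mean_sign_form_sqr (e : multi_index r -> R) :
    (forall alpha, e alpha ^+ 2 = 1) ->
  E (fun x => (\sum_alpha mono x alpha * e alpha) ^+ 2) = 1.
Proof.
move=> e1.
have tt alpha beta : tame (fun x => mono x alpha * mono x beta).
  by apply: tameM; exact: tame_mono.
transitivity (\sum_alpha \sum_beta (e alpha * e beta) *
    E (fun x => mono x alpha * mono x beta)).
  under [RHS]eq_bigr => a _.
    under eq_bigr => b _ do rewrite -meanZ //.
    rewrite -mean_sum => [|b]; last by apply: tameM; [exact: tame_cst|].
    over.
  rewrite -mean_sum => [|a]; last first.
    by apply: tame_sum => b; apply: tameM; [exact: tame_cst|].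
  apply: eq_Rintegral => x _; rewrite expr2 mulr_suml; apply: eq_bigr => a _.
  by rewrite mulr_sumr; apply: eq_bigr => b _; rewrite [RHS]mulrC mulrACA.
transitivity (\sum_alpha E (fun x => mono x alpha * mono x alpha)).
  apply: eq_bigr => a _; rewrite (bigD1 a) //= big1 => [|b ba].
    by rewrite addr0 -expr2 e1 mul1r.
  by rewrite mean_mono_mono ?mulr0 // eq_sym.
rewrite -mean_sum // -[RHS]mean_cst; apply: eq_Rintegral => x /set_mem Sx.
under eq_bigr do rewrite -expr2.
by rewrite sum_mono_sqr big1 // => nu _; rewrite [norm2 _]Sx expr1n.
Qed.

(** Orbits replace a support argument. The quadratic forms that vanish almost
    everywhere are spanned by finitely many of them, which have a common zero
    x0 on the spheres because the union of their exceptional sets is negligible.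
    Any point of the spheres is U x0 for some orthogonal U, and c composed with U
    still vanishes almost everywhere, so it vanishes at x0. *)
Lemma qform_ae_eq0 c :
    mu.-negligible (spheres `&` [set x | qform c x != 0]) ->
  forall x, spheres x -> qform c x = 0.
Proof.
pose C : vectType R := {ffun multi_index r * multi_index r -> R^o}.
pose Z (c' : C) : set (borel_vecs R r) := spheres `&` [set x | qform c' x != 0].
move=> Zc; have [s [sZ sgen]] := ex_finite_generators (fun c' : C => mu.-negligible (Z c')).
have [x0 Sx0 x0s] : exists2 x0, spheres x0 & forall c', c' \in s -> qform c' x0 = 0.
  apply: contrapT => no_x0.
  suff : mu.-negligible (spheres : set (borel_vecs R r)).
    move/negligibleP => /(_ measurable_spheres).
    by move/eqP; rewrite [X in X == _](mu_spheres sigma_sphere mu_prod) onee_eq0.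
  have : mu.-negligible [set x : borel_vecs R r |
      spheres x /\ exists2 c', c' \in s & qform c' x != 0].
    elim: s sZ {sgen no_x0} => [|c1 s IHs] sZ.
      by apply: negligibleS (negligible_set0 mu) => x [_ []].
    have Z1 : mu.-negligible (Z c1) by apply: sZ; rewrite mem_head.
    have Zs := IHs (fun c' c's => sZ c' (mem_behead (s := c1 :: s) c's)).
    apply: negligibleS (negligibleU Z1 Zs) => x [Sx [c']].
    by rewrite inE => /predU1P[->|c's] c'x; [left|right; split=> //; exists c'].
  apply: negligibleS => x Sx; split=> //.
  apply: contrapT => nox; apply: no_x0; exists x => // c' c's.
  by apply/eqP; apply: contrapT => /negP c'x; apply: nox; exists c'.
move=> x Sx; have [U UU ->] := spheres_transitive Sx0 Sx.
have [c' c'E] := qform_mulmx U c.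
rewrite c'E; apply: qform_span x0s _; apply: sgen.
case: Zc => A [mA A0 ZA]; exists (mulmx_vecs U @^-1` A); split.
- have := measurable_mulmx_vecs U measurableT mA; by rewrite setTI.
- exact: etrans (mu_mulmx_vecs sigma_sphere mu_prod UU mA) A0.
- move=> y [Sy /= cy]; apply: ZA; split; first exact/spheres_mulmx.
  by rewrite /= c'E.
Qed.

End Means.

(** * The form and its operator-valued map *)

Section FormNorm.
Context {R : realType} {q : nat} {r : 'I_q -> nat} {m n : nat}.
Context (T : multi_index r -> 'M[R]_(m, n)).

(** The sum of the absolute values of all coefficients is an upper bound of the
    set whose supremum is taken. *)
Lemma tensor_form_le_norm (x : vecs R r) (y : 'cV[R]_m) (z : 'cV[R]_n) :
    (forall nu, norm2 (x nu) <= 1) -> norm2 y <= 1 -> norm2 z <= 1 ->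
  `|tensor_form T x y z| <= form_norm (tensor_form T).
Proof.
move=> x1 y1 z1; apply: ub_le_sup; last by exists x, y, z.
exists (\sum_alpha \sum_j \sum_s `|T alpha j s|).
move=> _ [x' [y' [z' [x'1 y'1 z'1 ->]]]].
apply: le_trans (ler_norm_sum _ _ _) _; apply: ler_sum => alpha _.
apply: le_trans (ler_norm_sum _ _ _) _; apply: ler_sum => j _.
apply: le_trans (ler_norm_sum _ _ _) _; apply: ler_sum => s _.
rewrite !normrM -!mulrA -[leRHS]mulr1 ler_wpM2l //.
rewrite mulr_ile1 ?mulr_ge0 //.
  rewrite normr_prod prodr_ile1 // => nu _; rewrite normr_ge0 /=.
  exact: le_trans (norm_coord_le _ _) (x'1 nu).
by rewrite mulr_ile1 // (le_trans (norm_coord_le _ _)).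
Qed.

Lemma form_norm_ge0 : 0 <= form_norm (tensor_form T).
Proof.
apply: le_trans (tensor_form_le_norm (x := fun=> 0) (y := 0) (z := 0) _ _ _);
  by rewrite // => *; exact: norm2_0_le1.
Qed.

Lemma form_norm_le K :
    (forall x y z, (forall nu, norm2 (x nu) <= 1) -> norm2 y <= 1 ->
      norm2 z <= 1 -> `|tensor_form T x y z| <= K) ->
  form_norm (tensor_form T) <= K.
Proof.
move=> TK; apply: ge_sup; last by move=> _ [x [y [z [x1 y1 z1 ->]]]]; exact: TK.
exists `|tensor_form T (fun=> 0) 0 0|, (fun=> 0), 0, 0; split=> // *; exact: norm2_0_le1.
Qed.

Lemma op_mapE x i s : op_map T x i s = \sum_alpha mono x alpha * T alpha i s.
Proof. by rewrite /op_map summxE; apply: eq_bigr => alpha _; rewrite mxE. Qed.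

Lemma op_map_le (x : vecs R r) : (0 < m)%N -> (0 < n)%N -> spheres x ->
  (forall z, norm2 (op_map T x *m z) <= form_norm (tensor_form T) * norm2 z) /\
  (forall y, norm2 ((op_map T x)^T *m y) <= form_norm (tensor_form T) * norm2 y).
Proof.
move=> m0 n0 Sx.
have bound (u : 'cV[R]_m) (v : 'cV[R]_n) : norm2 u = 1 -> norm2 v = 1 ->
    (u^T *m (op_map T x *m v)) 0 0 <= form_norm (tensor_form T).
  move=> u1 v1; rewrite -tensor_formE (le_trans (ler_norm _)) //.
  by apply: tensor_form_le_norm => [nu||]; rewrite ?u1 ?v1 // [norm2 _]Sx.
split; apply: norm2_mulmx_le => // v u v1 u1.
suff -> : (v^T *m ((op_map T x)^T *m u)) 0 0 = (u^T *m (op_map T x *m v)) 0 0.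
  exact: bound.
by rewrite -[in LHS](trmxK u) -!trmx_mul mxE mulmxA.
Qed.

(** The entry (i, j) of S - n I after the constant 1 has been replaced by the
    product of the squared norms, that is, by the sum of the squared monomials:
    this makes it homogeneous, and changes nothing on the spheres. *)
Definition defect_coef i j : {ffun multi_index r * multi_index r -> R^o} :=
  [ffun p => (T p.1 *m (T p.2)^T) i j - n%:R * ((p.1 == p.2) && (i == j))%:R].

Lemma qform_defect i j x :
  qform (defect_coef i j) x =
  (op_map T x *m (op_map T x)^T - (n%:R * \prod_nu norm2 (x nu) ^+ 2)%:M) i j.
Proof.
rewrite /qform; under [LHS]eq_bigr do rewrite ffunE mulrBl.
rewrite sumrB !mxE; congr (_ - _).
  rewrite -(pair_bigA _ (fun a b => (T a *m (T b)^T) i j * (mono x a * mono x b))) /=.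
  under [RHS]eq_bigr => s _.
    rewrite mxE !op_mapE mulr_suml.
    under eq_bigr do rewrite mulr_sumr.
    over.
  rewrite [RHS]exchange_big; apply: eq_bigr => a _ /=.
  rewrite [RHS]exchange_big; apply: eq_bigr => b _ /=.
  rewrite mxE mulr_suml; apply: eq_bigr => s _.
  by rewrite mxE; ring.
rewrite -(pair_bigA _ (fun a b =>
  n%:R * ((a == b) && (i == j))%:R * (mono x a * mono x b))) /=.
rewrite -sum_mono_sqr mulr_sumr -sumrMnl; apply: eq_bigr => a _.
rewrite (bigD1 a) //= big1 => [|b ba]; last by rewrite eq_sym (negPf ba) mulr0 mul0r.
rewrite eqxx addr0; case: (i == j); last by rewrite mulr0 mul0r.
by rewrite mulr1 mulr1n expr2.
Qed.

End FormNorm.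

(** * The defect and the norm *)

Section Defect.
Context {R : realType} {q : nat} {r : 'I_q -> nat} {m n : nat}.
Context (r_gt0 : forall nu, (0 < r nu)%N) (m_gt0 : (0 < m)%N) (n_gt0 : (0 < n)%N).
Context (T : multi_index r -> 'M[R]_(m, n)) (T_sign : is_sign_tensor T).
Context (sigma : forall nu, probability (borel_cV R (r nu)) R)
  (sigma_sphere : forall nu, is_sphere_measure (sigma nu))
  (mu : probability (borel_vecs R r) R) (mu_prod : is_product_measure sigma mu).

Local Notation N := (form_norm (tensor_form T)).
Local Notation S x := (op_map T x *m (op_map T x)^T).

Lemma hs_norm_defect (x : vecs R r) : spheres x ->
  hs_norm (S x - n%:R%:M) ^+ 2 = \sum_i \sum_j qform (defect_coef T i j) x ^+ 2.
Proof.
move=> Sx; rewrite hs_norm_sqr; apply: eq_bigr => i _; apply: eq_bigr => j _.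
rewrite qform_defect big1 ?mulr1 // => nu _.
by rewrite [norm2 _]Sx expr1n.
Qed.

Lemma tame_defect :
  tame (fun x : vecs R r => \sum_i \sum_j qform (defect_coef T i j) x ^+ 2).
Proof.
apply: tame_sum => i; apply: tame_sum => j; under eq_fun do rewrite expr2.
by apply: tameM; exact: tame_qform.
Qed.

Lemma deltaE : delta T mu = (m%:R * n%:R ^+ 2)^-1 *
  \int[mu]_(x in spheres) \sum_i \sum_j qform (defect_coef T i j) x ^+ 2.
Proof.
congr (_ * _); apply: eq_Rintegral => x /set_mem Sx; exact: hs_norm_defect.
Qed.

Lemma mean_trace : \int[mu]_(x in spheres) \tr (S x) = m%:R * n%:R.
Proof.
have tt i s : tame (fun x : vecs R r => (\sum_alpha mono x alpha * T alpha i s) ^+ 2).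
  have t1 : tame (fun x : vecs R r => \sum_alpha mono x alpha * T alpha i s).
    by apply: tame_sum => a; apply: tameM; [exact: tame_mono|exact: tame_cst].
  by under eq_fun do rewrite expr2; exact: tameM.
transitivity (\int[mu]_(x in spheres)
    \sum_i \sum_s (\sum_alpha mono x alpha * T alpha i s) ^+ 2).
  apply: eq_Rintegral => x _; apply: eq_bigr => i _; rewrite mxE.
  by apply: eq_bigr => s _; rewrite mxE op_mapE expr2.
rewrite (mean_sum sigma_sphere mu_prod) => [|i]; last exact: tame_sum.
transitivity (\sum_(i < m) \sum_(s < n) (1 : R)); last first.
  by rewrite !sumr_const !card_ord -mulrnA -natrM mulnC.
apply: eq_bigr => i _; rewrite (mean_sum sigma_sphere mu_prod) //.
apply: eq_bigr => s _; apply: (mean_sign_form_sqr sigma_sphere mu_prod) => a.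
by case: (T_sign a i s) => ->; rewrite ?sqrrN expr1n.
Qed.

(** On the spheres the integrand of delta is at most
    m N^4 + m n^2 - 2 n tr S, whose mean is m N^4 - m n^2. *)
Lemma one_add_delta_le : n%:R ^+ 2 * (1 + delta T mu) <= N ^+ 4.
Proof.
have mR : 0 < m%:R :> R by rewrite ltr0n.
have nR : 0 < n%:R :> R by rewrite ltr0n.
have Ile : \int[mu]_(x in spheres) \sum_i \sum_j qform (defect_coef T i j) x ^+ 2
    <= m%:R * N ^+ 4 + m%:R * n%:R ^+ 2 - 2 * n%:R * (m%:R * n%:R).
  have ttr : tame (fun x : vecs R r => \tr (S x)).
    apply: tame_sum => i; under eq_fun do rewrite mxE.
    have t1 s : tame (fun x : vecs R r => op_map T x i s).
      under eq_fun do rewrite op_mapE.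
      by apply: tame_sum => a; apply: tameM; [exact: tame_mono|exact: tame_cst].
    by apply: tame_sum => s; under eq_fun do rewrite mxE; exact: tameM.
  have tZ : tame (fun x : vecs R r => - (2 * n%:R) * \tr (S x)).
    by apply: tameM => //; exact: tame_cst.
  set C := m%:R * N ^+ 4 + m%:R * n%:R ^+ 2.
  apply: (@le_trans _ _ (\int[mu]_(x in spheres) (C + - (2 * n%:R) * \tr (S x)))).
    apply: le_Rintegral; first exact: measurable_spheres.
    - exact: (tame_integrable sigma_sphere mu_prod tame_defect).
    - by apply: (tame_integrable sigma_sphere mu_prod); apply: tameD => //; exact: tame_cst.
    move=> x Sx /=; rewrite -hs_norm_defect // hs_norm_sub_scalar /C.
    have [MK MTK] := op_map_le T m_gt0 n_gt0 Sx.
    by have := hs_norm_gram_le MK MTK; lra.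
  rewrite RintegralD; last 3 first.
  - exact: measurable_spheres.
  - by apply: (tame_integrable sigma_sphere mu_prod); exact: tame_cst.
  - exact: (tame_integrable sigma_sphere mu_prod tZ).
  rewrite (mean_cst sigma_sphere mu_prod) (meanZ sigma_sphere mu_prod) //.
  by rewrite mean_trace mulNr.
rewrite deltaE; set I := \int[mu]_(x in _) _ in Ile *.
rewrite -(ler_pM2l mR).
have -> : m%:R * (n%:R ^+ 2 * (1 + (m%:R * n%:R ^+ 2)^-1 * I)) = m%:R * n%:R ^+ 2 + I.
  by field; rewrite !gt_eqF.
by move: Ile; lra.
Qed.

Lemma delta_ge0 : 0 <= delta T mu.
Proof.
apply: mulr_ge0; first by rewrite invr_ge0 mulr_ge0 ?sqr_ge0.
by apply: Rintegral_ge0 => x _; exact: sqr_ge0.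
Qed.

(** The integrand of delta is a sum of squares with integral 0. *)
Lemma delta_eq0_negligible i j : delta T mu = 0 ->
  mu.-negligible (spheres `&` [set x | qform (defect_coef T i j) x != 0]).
Proof.
have mR : 0 < m%:R :> R by rewrite ltr0n.
have nR : 0 < n%:R :> R by rewrite ltr0n.
rewrite deltaE => /eqP.
rewrite mulf_eq0 invr_eq0 mulf_eq0 sqrf_eq0 (gt_eqF mR) (gt_eqF nR) /=.
set h := fun x => \sum_i _; rewrite -[\int[mu]_(x in _) _]/(\int[mu]_(x in spheres) h x).
move=> /eqP I0.
have h0 x : 0 <= h x.
  by apply: sumr_ge0 => i' _; apply: sumr_ge0 => j' _; exact: sqr_ge0.
have [mh bh] := tame_defect.
have mhE : measurable_fun [set: borel_vecs R r] (EFin \o h) by apply/measurable_EFinP.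
have ih := tame_integrable sigma_sphere mu_prod tame_defect.
have mS : measurable (@spheres R q r) by exact: measurable_spheres.
have : (\int[mu]_(x in spheres) `|(h x)%:E| = 0)%E.
  under eq_integral do rewrite gee0_abs ?lee_fin //.
  by rewrite -[LHS]fineK; [rewrite [fine _]I0|exact: integrable_fin_num ih].
move/(ae_eq_integral_abs mu mS (measurable_funTS mhE)).
apply: negligibleS => x [Sx /= cx] hx; move: cx; apply/negP; rewrite negbK.
have /eqP := hx Sx; rewrite eqe psumr_eq0; last first.
  by move=> k _; apply: sumr_ge0 => l _; exact: sqr_ge0.
move=> /allP/(_ i); rewrite mem_index_enum => /(_ isT) /=.
rewrite psumr_eq0; last by move=> l _; exact: sqr_ge0.
by move=> /allP/(_ j); rewrite mem_index_enum sqrf_eq0 => /(_ isT).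
Qed.

(** On the spheres this is [qform_ae_eq0]; both sides are homogeneous of
    degree 2 in each variable. *)
Lemma delta_eq0_gram (x : vecs R r) : delta T mu = 0 ->
  S x = (n%:R * \prod_nu norm2 (x nu) ^+ 2)%:M.
Proof.
move=> d0; apply/eqP; rewrite -subr_eq0; apply/eqP/matrixP => i j.
rewrite -qform_defect [RHS]mxE.
have u_ nu : {u : 'cV[R]_(r nu) | norm2 u = 1 & x nu = norm2 (x nu) *: u}.
  by apply/cid2/cV_polar.
pose u : vecs R r := fun nu => s2val (u_ nu).
have -> : x = fun nu => norm2 (x nu) *: u nu.
  by apply/functional_extensionality_dep => nu; exact: s2valP' (u_ nu).
have Su : spheres u by move=> nu; exact: s2valP (u_ nu).
have qu : qform (defect_coef T i j) u = 0.
  by apply: (qform_ae_eq0 sigma_sphere mu_prod) => //; exact: delta_eq0_negligible.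
rewrite /qform; under eq_bigr do
  rewrite !mono_scale [X in _ * X]mulrACA (mulrCA (defect_coef _ _ _ _)).
by rewrite -mulr_sumr [X in _ * X]qu mulr0.
Qed.

Lemma prod_norm2_ge0 (x : vecs R r) : 0 <= \prod_nu norm2 (x nu).
Proof. by apply: prodr_ge0 => nu _; exact: norm2_ge0. Qed.

Lemma gram_norm2 (x : vecs R r) (y : 'cV[R]_m) :
    S x = (n%:R * \prod_nu norm2 (x nu) ^+ 2)%:M ->
  norm2 ((op_map T x)^T *m y) = Num.sqrt n%:R * (\prod_nu norm2 (x nu)) * norm2 y.
Proof.
have p0 := prod_norm2_ge0 x.
move=> SE; apply: eq_norm2; first by rewrite !mulr_ge0 ?norm2_ge0 ?sqrtr_ge0.
rewrite !exprMn (sqr_sqrtr (ler0n _ _)) -prodrXl norm2_sqrE trmx_mul trmxK.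
by rewrite -mulmxA (mulmxA (op_map T x)) SE mul_scalar_mx -scalemxAr mxE -norm2_sqrE.
Qed.

Lemma form_norm_le_sqrt :
    (forall (x : vecs R r) (y : 'cV[R]_m), norm2 ((op_map T x)^T *m y) =
      Num.sqrt n%:R * (\prod_nu norm2 (x nu)) * norm2 y) ->
  N <= Num.sqrt n%:R.
Proof.
move=> iso; apply: form_norm_le => x y z x1 y1 z1.
rewrite tensor_formE mulmxA -{1}(trmxK (op_map T x)) -trmx_mul.
apply: le_trans (cauchy_schwarz _ _) _; rewrite iso -!mulrA -[leRHS]mulr1.
rewrite ler_wpM2l ?sqrtr_ge0 //.
have p0 := prod_norm2_ge0 x.
rewrite mulr_ile1 ?mulr_ge0 ?norm2_ge0 //; last by rewrite mulr_ile1 ?norm2_ge0.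
by apply: prodr_ile1 => nu _; rewrite norm2_ge0 x1.
Qed.

End Defect.

Theorem theorem2 (R : realType) (k : nat) (k_ge3 : (3 <= k)%N)
    (r : 'I_(k - 2) -> nat) (m n : nat)
    (r_gt0 : forall nu, (0 < r nu)%N) (m_gt0 : (0 < m)%N) (n_gt0 : (0 < n)%N)
    (le_mn : (m <= n)%N)
    (T : multi_index r -> 'M[R]_(m, n)) (T_sign : is_sign_tensor T)
    (sigma : forall nu : 'I_(k - 2), probability (borel_cV R (r nu)) R)
    (sigma_sphere : forall nu, is_sphere_measure (sigma nu))
    (mu : probability (borel_vecs R r) R)
    (mu_prod : is_product_measure sigma mu) :
  (1 + delta T mu) `^ (4%:R^-1) <=
    form_norm (tensor_form T) / Num.sqrt n%:R /\
  [<-> form_norm (tensor_form T) = Num.sqrt n%:R;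
       delta T mu = 0;
       forall x : vecs R r,
         op_map T x *m (op_map T x)^T =
           (n%:R * \prod_(nu < k - 2) norm2 (x nu) ^+ 2)%:M;
       forall (x : vecs R r) (y : 'cV[R]_m),
         norm2 ((op_map T x)^T *m y) =
           Num.sqrt n%:R * (\prod_(nu < k - 2) norm2 (x nu)) * norm2 y].
Proof.
have sn : 0 < Num.sqrt n%:R :> R by rewrite sqrtr_gt0 ltr0n.
have sn4 : Num.sqrt n%:R ^+ 4 = n%:R ^+ 2 :> R.
  by rewrite (exprM _ 2 2) sqr_sqrtr.
have N0 := form_norm_ge0 T; have d0 := delta_ge0 T mu.
have main : 1 + delta T mu <= (form_norm (tensor_form T) / Num.sqrt n%:R) ^+ 4.
  rewrite expr_div_n sn4 ler_pdivlMr ?exprn_gt0 ?ltr0n // mulrC.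
  exact: (one_add_delta_le m_gt0 n_gt0 T_sign sigma_sphere mu_prod).
have Q0 : 0 <= form_norm (tensor_form T) / Num.sqrt n%:R by rewrite divr_ge0 // ltW.
split.
  have -> : form_norm (tensor_form T) / Num.sqrt n%:R =
      ((form_norm (tensor_form T) / Num.sqrt n%:R) ^+ 4) `^ (4%:R^-1).
    by rewrite -(powR_mulrn 4 Q0) -powRrM divff ?powRr1 // pnatr_eq0.
  by apply: ge0_ler_powR; rewrite ?nnegrE ?addr_ge0 ?exprn_ge0 ?invr_ge0.
tfae.
- move=> NE; apply: le_anti; rewrite d0 andbT.
  by move: main; rewrite NE divff ?gt_eqF // expr1n; lra.
- move=> dE x.
  exact: (delta_eq0_gram r_gt0 m_gt0 n_gt0 sigma_sphere mu_prod).
- by move=> gram x y; apply: gram_norm2.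
- move=> /form_norm_le_sqrt N_le; apply: le_anti; rewrite N_le /=.
  rewrite -[leLHS]mul1r -ler_pdivlMr // -(@expr_ge1 _ 4) //.
  by apply: le_trans main; rewrite lerDl.
Qed.
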